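(* Fix $q>1$ and $N\ge1$. For a finite box $\Lambda=(V,E)$ of $\mathbb{Z}^2$, let $Z_\Lambda\in[0,1]^{E}$ be sampled from Grimmett's monotone coupling measure $\mu_\Lambda$. Then the probability that a cloud of at least $N$ edges appears simultaneously in $\omega_p(Z_\Lambda)$ at some $p\in(0,1)$, i.e. that there exist $p\in(0,1)$ and at least $N$ edges $e\in E$ with $Z_\Lambda(e)=p$, converges to $1$ as the box $\Lambda\nearrow\mathbb{Z}^2$.
   Context: Grimmett's monotone coupling: fix $q\ge1$ and a finite box $\Lambda=(V,E)$ of $\mathbb{Z}^2$ (with free boundary condition unless specified otherwise; if boundary vertices are wired, connections below may use the wirings). For $Z\in[0,1]^E$ and $p\in[0,1]$, define $\omega_p(Z)\in\{0,1\}^E$ by $\omega_p(Z)(e)=1_{Z(e)\le p}$. For $e=\langle x,y\rangle\in E$ let $\mathcal D_e\subset\{0,1\}^E$ be the event that there is a path of open edges in $E\setminus\{e\}$ connecting $x$ and $y$, and let $T_e(Z)=\inf\{p\in[0,1]:\ \omega_p(Z)\in\mathcal D_e\}$ (with $T_e(Z)=1$ if the set is empty). Consider the continuous-time Markov chain $(Z_t)$ on $[0,1]^E$ in which each edge $e$ is updated at rate one, independently; when $e$ is updated at time $t$, its label is replaced by a new random label $\mathcal U_e$ which, given $Z_{t-}$, has distribution function $$\mathbb P[\mathcal U_e\le p]=\begin{cases}p&\text{if }p\ge T,\\ \dfrac{p}{p+(1-p)q}&\text{if }p<T,\end{cases}\qquad T=T_e(Z_{t-}).$$ $\mu_\Lambda$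 is the unique invariant probability measure of this chain; under it $\omega_p(Z)$ has the law of the random-cluster model on $\Lambda$ with parameters $(p,q)$, for each $p\in[0,1]$. For $Z\sim\mu_\Lambda$ and $e\in E$, the cloud of $e$ is $\{f\in E: Z(f)=Z(e)\}$, the set of edges which appear simultaneously with $e$ as $p$ increases. *)

(* Defs.v *)
From HB Require Import structures.
From mathcomp Require Import all_boot all_order all_algebra finmap.
From mathcomp Require Import all_classical all_reals all_analysis.
From mathcomp Require Import zify lra.
Set Implicit Arguments.
Unset Strict Implicit.
Unset Printing Implicit Defensive.
Import Order.TTheory GRing.Theory Num.Theory.
Import numFieldNormedType.Exports.
Local Open Scope classical_set_scope.
Local Open Scope ring_scope.

Definition site : Type := (int * int)%type.

(* An edge of Z^2 is encoded by its lower-left endpoint and its direction: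
   (v, false) joins v to v + (1, 0), and (v, true) joins v to v + (0, 1). *)
Definition lattice_edge : Type := (site * bool)%type.

Definition edge_src (e : lattice_edge) : site := e.1.
Definition edge_tgt (e : lattice_edge) : site :=
  if e.2 then (e.1.1, e.1.2 + 1) else (e.1.1 + 1, e.1.2).

Definition joins (e : lattice_edge) (x y : site) : bool :=
  ((x == edge_src e) && (y == edge_tgt e)) ||
  ((x == edge_tgt e) && (y == edge_src e)).

(* The box with corner (a, b), width w and height h is
   {a, ..., a + w} x {b, ..., b + h}. *)
Record box := Box { corner : site ; width : nat ; height : nat }.

Definition vertices (L : box) : {fset int * int} :=
  [fset ((corner L).1 + i%:Z, (corner L).2 + j%:Z)%R
     | i in iota 0 (width L).+1, j in iota 0 (height L).+1]%fset.

Definition edges (L : box) : {fset int * int * bool} :=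
  [fset e in (vertices L `*` [fset false; true])
     | edge_tgt e \in vertices L]%fset.

Lemma in_vertices (L : box) (v : site) :
  (v \in vertices L) =
  [&& (corner L).1 <= v.1, v.1 <= (corner L).1 + (width L)%:Z,
      (corner L).2 <= v.2 & v.2 <= (corner L).2 + (height L)%:Z].
Proof.
case: L v => -[a b] w h [x y].
apply/imfset2P/idP => [[i iw [j jh [-> ->]]]|/= xy].
  by move: i j iw jh => /= i j; rewrite !inE !mem_iota; lia.
exists `|x - a|%N; first by rewrite /= !inE mem_iota; lia.
exists `|y - b|%N; first by rewrite /= !inE mem_iota; lia.
by congr (_, _) => /=; lia.
Qed.

Lemma in_edges (L : box) (e : lattice_edge) :
  (e \in edges L) = (edge_src e \in vertices L) && (edge_tgt e \in vertices L).
Proof.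
rewrite /edges !inE /=; congr (_ && _).
by rewrite /edge_src; case: (e.2); rewrite andbT.
Qed.

(* The filter of properties that hold for all boxes large enough for inclusion,
   i.e. the limit as the box increases to Z^2. *)
Definition boxes_to_plane : set_system box :=
  [set P | exists L0, forall L, (vertices L0 `<=` vertices L)%fset -> P L].

#[global] Instance boxes_to_plane_filter : ProperFilter boxes_to_plane.
Proof.
split; first by case=> L /(_ L (fsubset_refl _)).
split; first by exists (Box (0, 0) 0 0).
  move=> P Q [L1 P1] [L2 Q2].
  pose a := Num.min (corner L1).1 (corner L2).1.
  pose b := Num.min (corner L1).2 (corner L2).2.
  pose w := (`|(corner L1).1 - a| + `|(corner L2).1 - a| + width L1 + width L2)%N.
  pose h := (`|(corner L1).2 - b| + `|(corner L2).2 - b| + height L1 + height L2)%N.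
  exists (Box (a, b) w h) => L sL; split; [apply: P1|apply: Q2];
    apply: fsubset_trans sL; apply/fsubsetP => v; rewrite !in_vertices /=;
    rewrite /w /h /a /b; lia.
by move=> P Q PQ [L0 h]; exists L0 => L /h/PQ.
Qed.

Section configurations.
Variables (R : realType) (L : box).

(* Labels are real-valued functions on the edges of the box, with the product
   sigma-algebra; the state space of the chain is the subset [unit_cube]. *)
Definition labelling_cylinders : set (set (edges L -> R)) :=
  [set A | exists e (B : set R), measurable B /\ A = [set z | B (z e)]].

Definition labelling : Type := g_sigma_algebraType labelling_cylinders.

HB.instance Definition _ := Measurable.on labelling.

Definition unit_cube : set labelling := [set z | forall e, 0 <= z e <= 1].

Definition omega (p : R) (z : labelling) : pred (edges L) := fun e => z e <= p.

Definition open_step (w : pred (edges L)) (e : edges L) : rel site :=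
  fun x y => [exists f : edges L, [&& f != e, w f & joins (val f) x y]].

Definition linked_off (e : edges L) (w : pred (edges L)) : Prop :=
  exists s : seq site, path (open_step w e) (edge_src (val e)) s /\
                       last (edge_src (val e)) s = edge_tgt (val e).

Definition linking_levels (e : edges L) (z : labelling) : set R :=
  [set p | 0 <= p <= 1 /\ linked_off e (omega p z)].

(* The infimum of the empty set is 0 in the library, whereas T_e is 1 then. *)
Definition threshold (e : edges L) (z : labelling) : R :=
  if linking_levels e z == set0 then 1 else inf (linking_levels e z).

Definition relabel (e : edges L) (u : R) (z : labelling) : labelling :=
  fun f => if f == e then u else z f.

End configurations.

Section update_law.
Variable R : realType.

Definition update_df (q T p : R) : R :=
  if T <= p then p else p / (p + (1 - p) * q).

Definition clamp01 (p : R) : R := Num.max 0 (Num.min p 1).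

(* The distribution function of the new label, extended from [0, 1] to R. It is
   nondecreasing only for q >= 1, hence the argument [q1], which the instances
   below need. *)
Definition update_cdf (q : R) (q1 : 1 <= q) (T p : R) : R :=
  update_df q T (clamp01 p).

Lemma clamp01_id (p : R) : 0 <= p <= 1 -> clamp01 p = p.
Proof. by case/andP=> p0 p1; rewrite /clamp01 (min_idPl p1) (max_idPr p0). Qed.

Lemma clamp01_itv (p : R) : 0 <= clamp01 p <= 1.
Proof. by rewrite /clamp01 le_max lexx /= ge_max ler01 ge_min lexx orbT. Qed.

Lemma clamp01_homo : {homo clamp01 : x y / x <= y}.
Proof.
move=> x y xy; rewrite /clamp01 ge_max !le_max lexx /= !le_min !ge_min.
by rewrite xy lexx !orbT.
Qed.

Lemma clamp01_continuous : continuous clamp01.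
Proof.
move=> x; apply: (@continuous_max R R (cst 0) (fun p => Num.min p 1) x).
  exact: cvg_cst.
by apply: (@continuous_min R R id (cst 1) x); [exact: cvg_id|exact: cvg_cst].
Qed.

Section cumulative.
Variables (q : R) (q1 : 1 <= q) (T : R).

Let den_gt0 (p : R) : 0 <= p <= 1 -> 0 < p + (1 - p) * q.
Proof.
move=> /andP[p0 p1].
have : 0 <= (1 - p) * (q - 1) by rewrite mulr_ge0 // subr_ge0.
by lra.
Qed.

Let update_cdf_nd : nondecreasing (update_cdf q1 T).
Proof.
move=> x y /clamp01_homo; rewrite /update_cdf /update_df.
move: (clamp01_itv x) (clamp01_itv y); move: (clamp01 x) (clamp01 y) => c d.
move=> c01 d01 cd; have c0 := den_gt0 c01; have d0 := den_gt0 d01.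
have cq : c * q <= d * q by rewrite ler_wpM2r // (le_trans _ q1).
move: c01 d01 => /andP[c_ge0 c_le1] /andP[d_ge0 d_le1].
have cc : 0 <= c * (1 - c) * (q - 1) by rewrite !mulr_ge0 ?subr_ge0.
have [Tc|cT] := leP T c; first by rewrite (le_trans Tc cd).
have [Td|dT] := leP T d; last first.
  by rewrite ler_pdivrMr // mulrAC ler_pdivlMr //; nra.
rewrite ler_pdivrMr // (le_trans _ (ler_wpM2r (ltW c0) cd)) //; lra.
Qed.

Let update_cdf_rc : right_continuous (update_cdf q1 T).
Proof.
move=> x; rewrite /update_cdf {2}/update_df; have [Tx|xT] := leP T (clamp01 x).
  apply: (@cvg_trans _ (clamp01 @ at_right x)).
    apply: near_eq_cvg; near=> y; rewrite /update_df ifT //.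
    by apply: le_trans Tx _; apply: clamp01_homo; apply: ltW; near: y;
       exact: nbhs_right_gt.
  by apply: cvg_at_right_filter; exact: clamp01_continuous.
apply: (@cvg_trans _
  ((fun y => clamp01 y / (clamp01 y + (1 - clamp01 y) * q)) @ at_right x)).
  apply: near_eq_cvg; near=> y; rewrite /update_df ifF //.
  apply: negbTE; rewrite -ltNge; near: y.
  apply: (cvgr_lt (clamp01 x)) => //.
  by apply: cvg_at_right_filter; exact: clamp01_continuous.
apply: cvg_at_right_filter; apply: cvgM; first exact: clamp01_continuous.
apply: cvgV; first by rewrite gt_eqF // den_gt0 // clamp01_itv.
apply: cvgD; first exact: clamp01_continuous.
apply: cvgM; last exact: cvg_cst.
by apply: cvgB; [exact: cvg_cst|exact: clamp01_continuous].
Unshelve. all: by end_near. Qed.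

HB.instance Definition _ :=
  isCumulative.Build R _ R (update_cdf q1 T) update_cdf_nd update_cdf_rc.

Let update_cdf_Ny : update_cdf q1 T @ -oo --> (0 : R).
Proof.
apply: (@cvg_trans _ (cst (0 : R) @ -oo)); last exact: cvg_cst.
apply: near_eq_cvg; near=> x; rewrite /update_cdf /clamp01.
have x0 : x <= 0 by near: x; exact: nbhs_ninfty_le.
rewrite (max_idPl _) ?ge_min ?x0 // /update_df mul0r.
by case: ifP.
Unshelve. all: by end_near. Qed.

Let update_cdf_y : update_cdf q1 T @ +oo --> (1 : R).
Proof.
apply: (@cvg_trans _ (cst (1 : R) @ +oo)); last exact: cvg_cst.
apply: near_eq_cvg; near=> x; rewrite /update_cdf /clamp01.
have x1 : 1 <= x by near: x; exact: nbhs_pinfty_ge.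
rewrite (min_idPr x1) (max_idPr ler01) /update_df subrr mul0r addr0 divr1.
by case: ifP.
Unshelve. all: by end_near. Qed.

HB.instance Definition _ :=
  isCumulativeBounded.Build R 0 1 (update_cdf q1 T) update_cdf_Ny update_cdf_y.

End cumulative.

Definition update_law (q : R) (q1 : 1 <= q) (T : R) :
    probability (measurableTypeR R) R :=
  lebesgue_stieltjes_measure (update_cdf q1 T).

Lemma update_lawE (q : R) (q1 : 1 <= q) (T p : R) : 0 <= p <= 1 ->
  update_law q1 T `]-oo, p]%classic =
    (if T <= p then p else p / (p + (1 - p) * q))%:E.
Proof.
move=> p01; have := cdf_lebesgue_stieltjes_id (update_cdf q1 T) p.
by rewrite /cdf /= preimage_id /update_cdf (clamp01_id p01).
Qed.

End update_law.

Section grimmett_chain.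
Variables (R : realType) (q : R) (q1 : 1 <= q) (L : box).
Local Open Scope ereal_scope.

(* Sum over all (e_1, ..., e_n) of the probability that the chain started
   at [z] is in [A] after the edges e_1, ..., e_n are updated in this order. *)
Fixpoint after_updates (A : set (labelling R L)) (n : nat)
    (z : labelling R L) : \bar R :=
  if n is n'.+1 then
    \sum_(e : edges L)
      \int[update_law q1 (threshold e z)]_u after_updates A n' (relabel e u z)
  else (\1_A z)%:E.

(* The probability that the chain started at [z] is in [A] at time [t]. The
   clocks of the edges being independent Poisson processes of rate one,
   exp(-|E| t) t^n / n! is the probability that they ring exactly n times
   before time t, on edges e_1, ..., e_n in this order. *)
Definition transition (t : R) (z : labelling R L) (A : set (labelling R L)) :
    \bar R :=
  \sum_(0 <= n <oo)
    (expR (- (#|{: edges L}|%:R * t)) * t ^+ n / n`!%:R)%:E *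
    after_updates A n z.

Definition invariant_measure (mu : probability (labelling R L) R) : Prop :=
  mu (@unit_cube R L) = 1 /\
  forall (t : R) (A : set (labelling R L)), (0 <= t)%R -> measurable A ->
    \int[mu]_z transition t z A = mu A.

(* The edges that appear in omega_p at level p are those with label p. *)
Definition large_cloud (N : nat) : set (labelling R L) :=
  [set z | exists p : R, (0 < p < 1)%R /\
           (N <= #|[pred e : edges L | z e == p]|)%N].

End grimmett_chain.

(* Main.v *)
Require Import Defs.
From HB Require Import structures.
From mathcomp Require Import all_boot all_order all_algebra finmap.
From mathcomp Require Import all_classical all_reals all_analysis.
From mathcomp Require Import measurable_realfun ring lra zify.
Set Implicit Arguments.
Unset Strict Implicit.
Unset Printing Implicit Defensive.
Import Order.TTheory GRing.Theory Num.Theory.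
Import numFieldNormedType.Exports.
Local Open Scope classical_set_scope.
Local Open Scope ring_scope.


(** A cloud of [N] edges is produced with positive probability by finitely many
    updates of the chain inside a region whose size depends on [N] only,
    whatever the labels elsewhere, and a large box contains many disjoint such
    regions.

    The region is a ladder. Its two rails are the rows [{x, ..., x + N - 1}] at
    heights 0 and 1; its rungs are the [N] vertical edges between them. Suppose
    that the first rung has a label [p] in [(1/3, 2/3]], that the labels of the
    rails are at most [1/3], and that every other edge with exactly one endpoint
    in the lower rail has a label at least [p]. Then the threshold of each other
    rung is exactly [p]: the rails and the first rung join its endpoints at
    level [p], and a path that joins them must leave the lower rail
    ([threshold_rung]). Since [q > 1], the law of the new label has an atom at
    the threshold, of mass at least [(q - 1) / (9 q)] here ([update_law_atom]).
    So the rungs can be updated one after the other to the common label [p],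
    and the situation is preserved by each of these updates. The whole scenario
    is a sequence of at most [5 N + 3] steps, each of which updates one edge and
    succeeds with probability at least some [c > 0] that depends on [q] only
    ([progress_step]).

    It remains to see that under the invariant measure some region has completed
    its scenario, with high probability when there are many regions. The measure
    is only used through its generator: letting the time tend to 0 in the
    invariance of [mu] bounds [mu A] by the mean of any measurable bound on the
    rate of jumping into [A] ([invariant_generator_le]). Let [D i k] be the
    event that the first [k] steps of the scenario of region [i] hold now, and
    [M S k] the probability that [D i (k i)] fails for all [i] in [S]. If [D i (k i)]
    fails but [D i (k i - 1)] holds, then an update in region [i] repairs it at
    rate at least [c]; and at most [n] edges of the region can destroy it. Hence
    [#|S| (n + c) M S k] is at most the sum over [i] in [S] of
    [n M (S - i) k + c M S k'], where [k'] is [k] lowered by one at [i]. This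
    recursion is solved by products: with [r j = 1 - (c / (n + c)) ^ j] one has
    [(n + c) r j = n + c r (j - 1)], hence [M S k] is at most the product of the
    [r (k i)] ([avoid_regions_le]). With [m] regions the probability that there
    is no large cloud is at most the [m]-th power of a constant smaller
    than 1. *)

(** * The generator inequality *)

(** The integral of a nonnegative function is a supremum over the simple
    functions below it, hence monotone even for functions that are not known to
    be measurable. As all that is used of the kernel are upper bounds, the
    measurability of the threshold in the labelling is thus never an issue. *)
Lemma ge0_le_integral_lower d (T : measurableType d) (R : realType)
    (mu : {measure set T -> \bar R}) (f g : T -> \bar R) :
  (forall x, 0 <= f x)%E -> (forall x, f x <= g x)%E ->
  (\int[mu]_x f x <= \int[mu]_x g x)%E.
Proof.
move=> f0 fg; have g0 x : (0 <= g x)%E := le_trans (f0 x) (fg x).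
rewrite !ge0_integralE//; apply: le_ereal_sup => _ [h hf <-]; exists h => //= x.
by apply: le_trans (hf x) _; rewrite !patchT ?inE.
Qed.

Lemma integral_affine d (T : measurableType d) (R : realType)
    (mu : probability T R) (A : set T) (g : T -> R) (b t k G : R) :
  measurable A -> measurable_fun setT g -> (forall z, 0 <= g z) ->
  (\int[mu]_z (g z)%:E = G%:E)%E -> 0 <= b -> 0 <= t -> 0 <= k ->
  (\int[mu]_z (b * \1_A z + t * g z + k)%:E =
   (b * fine (mu A) + t * G + k)%:E)%E.
Proof.
move=> mA mg g0 gG b0 t0 k0.
have mI : measurable_fun setT (\1_A : T -> R) by exact: measurable_indic.
have bI0 z : 0 <= b * (\1_A z : R) by rewrite mulr_ge0.
have tg0 z : 0 <= t * g z by rewrite mulr_ge0.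
have mbI : measurable_fun setT (fun z => (b * \1_A z)%:E : \bar R).
  by apply/measurable_EFinP; exact: measurable_funM.
have mtg : measurable_fun setT (fun z => (t * g z)%:E : \bar R).
  by apply/measurable_EFinP; exact: measurable_funM.
under eq_integral do rewrite !EFinD.
rewrite ge0_integralD//; first last.
- exact: emeasurable_funD.
- by move=> z _; rewrite -EFinD lee_fin addr_ge0.
rewrite ge0_integralD//.
have -> : (\int[mu]__ k%:E = k%:E)%E.
  by rewrite integral_cst// -[RHS]mule1; congr (_ * _)%E; exact: probability_setT.
under eq_integral do rewrite EFinM.
rewrite ge0_integralZl_EFin//; last exact/measurable_EFinP.
rewrite integral_indic// setIT.
under eq_integral do rewrite EFinM.
rewrite ge0_integralZl_EFin//; last exact/measurable_EFinP.
rewrite gG !EFinD !EFinM fineK ?fin_num_measure//.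
all: by move=> z _; rewrite lee_fin.
Qed.

Section generator.
Variables (R : realType) (q : R) (q1 : 1 <= q) (L : box).
Local Notation a := (#|{: edges L}|%:R : R).
Local Notation after := (after_updates q1).

Lemma after_updates_ge0 (A : set (labelling R L)) n z : (0 <= after A n z)%E.
Proof.
elim: n z => [|n IH] z /=; first by rewrite lee_fin.
by apply: sume_ge0 => e _; apply: integral_ge0 => u _; exact: IH.
Qed.

Lemma after_updates_le (A : set (labelling R L)) n z :
  (after A n z <= (a ^+ n)%:E)%E.
Proof.
elim: n z => [|n IH] z /=.
  by rewrite expr0 lee_fin indicE; case: (z \in A).
apply: (@le_trans _ _ (\sum_(e : edges L) (a ^+ n)%:E)%E); last first.
  by rewrite sumEFin lee_fin sumr_const exprS mulr_natl cardT.
apply: lee_sum => e _.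
apply: le_trans (ge0_le_integral_lower _ _ (g := cst (a ^+ n)%:E) _) _ => /=.
- by move=> u; exact: after_updates_ge0.
- by move=> u; exact: IH.
by rewrite integral_cst//= probability_setT mule1.
Qed.

Lemma transition_ge0 t z (A : set (labelling R L)) : 0 <= t ->
  (0 <= transition q1 t z A)%E.
Proof.
move=> t0; apply: nneseries_ge0 => n _ _.
by rewrite mule_ge0 ?after_updates_ge0// lee_fin divr_ge0// mulr_ge0 ?expR_ge0// exprn_ge0.
Qed.

(** The expansion of the semigroup to first order in [t]. As [after_updates] is at
    most [a ^+ n] after [n] updates, the terms of order at least 2 sum to at
    most [t ^+ 2 * expR a] when [t <= 1]. *)
Lemma transition_le (t : R) z (A : set (labelling R L)) (s : R) :
  0 <= t <= 1 -> (after A 1 z <= s%:E)%E ->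
  (transition q1 t z A <=
   (expR (- (a * t)) * (\1_A z + t * s + t ^+ 2 * expR a))%:E)%E.
Proof.
move=> /andP[t0 t1] As.
have s0 : 0 <= s by rewrite -lee_fin (le_trans _ As)// after_updates_ge0.
set w := expR (- (a * t)).
have w0 : 0 <= w by exact: expR_ge0.
(* Adding the remainder to the first two terms too lets it be summed as the
   whole exponential series. *)
pose v n : R := w * ((n == 0%N)%:R * \1_A z + (n == 1%N)%:R * (t * s)
   + t ^+ 2 * exp_coeff a n).
have ec n : 0 <= exp_coeff a n by exact: exp_coeff_ge0.
have I0 : (0 : R) <= \1_A z by [].
have uv n : ((w * t ^+ n / n`!%:R)%:E * after A n z <= (v n)%:E)%E.
  have c0 : 0 <= w * t ^+ n / n`!%:R by rewrite divr_ge0// mulr_ge0// exprn_ge0.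
  case: n c0 => [|[|n]] c0.
  - rewrite /= lee_fin /v expr0 mulr1 divr1 eqxx mul1r mul0r addr0.
    by rewrite ler_wpM2l// lerDl mulr_ge0// exprn_ge0.
  - apply: le_trans (lee_pmul _ _ (lexx _) As) _ => //.
      exact: after_updates_ge0.
    rewrite -EFinM lee_fin /v /= mul0r add0r mul1r divr1 expr1 -mulrA.
    by rewrite ler_wpM2l// lerDl mulr_ge0// exprn_ge0.
  apply: le_trans (lee_pmul _ _ (lexx _) (after_updates_le A n.+2 z)) _ => //.
    exact: after_updates_ge0.
  have -> : v n.+2 = w * (t ^+ 2 * (a ^+ n.+2 / (n.+2)`!%:R)).
    by rewrite /v !mul0r !add0r.
  rewrite -EFinM lee_fin.
  have tn : t ^+ n.+2 <= t ^+ 2.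
    by rewrite -addn2 exprD ler_piMl// ?exprn_ge0// exprn_ile1.
  have B0 : 0 <= a ^+ n.+2 / (n.+2)`!%:R by rewrite divr_ge0// exprn_ge0.
  move: (t ^+ n.+2) (t ^+ 2) (a ^+ n.+2) ((n.+2)`!%:R) tn B0 => T T2 B F TT B0.
  have -> : w * T / F * B = w * (T * (B / F)) by ring.
  by rewrite ler_wpM2l// ler_wpM2r.
have vs m : \sum_(0 <= n < m) v n <=
    w * (\1_A z + t * s + t ^+ 2 * expR a).
  rewrite -mulr_sumr ler_wpM2l// !big_split/= -mulr_sumr.
  rewrite lerD// ?lerD//.
  - case: m => [|m]; first by rewrite big_nil.
    rewrite big_nat_recl//= mul1r big1 ?addr0// => i _; by rewrite mul0r.
  - case: m => [|[|m]]; first by rewrite big_nil mulr_ge0.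
      by rewrite big_nat1 mul0r mulr_ge0.
    rewrite big_nat_recl// big_nat_recl//= mul1r mul0r add0r.
    by rewrite big1 ?addr0// => i _; rewrite mul0r.
  rewrite ler_wpM2l ?exprn_ge0//.
  apply: (@nondecreasing_cvgn_le _ (series (exp_coeff a))).
    by apply: nondecreasing_series => k _ _; exact: ec.
  exact: is_cvg_series_exp_coeff.
apply: lime_le.
  apply: is_cvg_nneseries => n _ _.
  by rewrite mule_ge0 ?after_updates_ge0// lee_fin divr_ge0// mulr_ge0// exprn_ge0.
apply: nearW => m; apply: (@le_trans _ _ (\sum_(0 <= n < m) (v n)%:E)%E).
  by apply: lee_sum => n _; exact: uv.
by rewrite sumEFin lee_fin; exact: vs.
Qed.

(** The rate of leaving [A] cannot exceed the rate of entering it: dividing the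
    invariance of [mu] by [t] and letting [t] tend to 0 yields
    [a * mu A <= \int after_updates A 1]. The subtracted term [C * \1_A] is
    moved to the left-hand side, so that only nonnegative functions are
    integrated. *)
Lemma invariant_generator_le (mu : probability (labelling R L) R)
    (hmu : invariant_measure q1 mu) (A : set (labelling R L)) (mA : measurable A)
    (C G : R) (g : labelling R L -> R) :
  0 <= C -> measurable_fun setT g ->
  (forall z, 0 <= g z) -> (\int[mu]_z (g z)%:E = G%:E)%E ->
  (forall z, (after A 1 z <= (g z - C * \1_A z)%:E)%E) ->
  (a + C) * fine (mu A) <= G.
Proof.
move=> C0 mg g0 gG Ag.
have muA : mu A = (fine (mu A))%:E by rewrite fineK// fin_num_measure.
set M := fine (mu A).
have M0 : 0 <= M by rewrite fine_ge0.
have G0 : 0 <= G.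
  by rewrite -lee_fin -gG; apply: integral_ge0 => z _; rewrite lee_fin.
have key (t : R) : 0 < t -> t <= 1 -> t * C <= 1 -> (a + C) * M <= G + t * expR a.
  move=> t0 t1 tC; have [_ /(_ t A (ltW t0) mA) inv] := hmu.
  pose w := expR (- (a * t)).
  have w0 : 0 <= w by exact: expR_ge0.
  have e0 : 0 <= t ^+ 2 * expR a by rewrite mulr_ge0 ?expR_ge0// exprn_ge0// ltW.
  have k0 : 0 <= w * (t ^+ 2 * expR a) by rewrite mulr_ge0.
  have wt0 : 0 <= w * t by rewrite mulr_ge0// ltW.
  have wC0 : 0 <= w * (1 - t * C) by rewrite mulr_ge0// subr_ge0.
  have h : M <= w * (1 - t * C) * M + w * t * G + w * (t ^+ 2 * expR a).
    rewrite -lee_fin -(integral_affine mA mg g0 gG wC0 wt0 k0) -muA -inv.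
    apply: ge0_le_integral_lower => z; first exact/transition_ge0/ltW.
    have t01 : 0 <= t <= 1 by rewrite ltW.
    apply: le_trans (transition_le t01 (Ag z)) _.
    by rewrite lee_fin -/w -!mulrA -!mulrDr ler_wpM2l//; lra.
  have : expR (a * t) * M <= (1 - t * C) * M + (t * G + t ^+ 2 * expR a).
    apply: le_trans (ler_wpM2l (expR_ge0 (a * t)) h) _.
    rewrite [leLHS](_ : _ = (expR (a * t) * w) *
        ((1 - t * C) * M + (t * G + t ^+ 2 * expR a))); last by ring.
    by rewrite /w expRxMexpNx_1 mul1r.
  have /(ler_wpM2r M0) e1 : 1 + a * t <= expR (a * t) by exact: expR_ge1Dx.
  move=> /(le_trans e1) h2.
  by rewrite -(ler_pM2l t0); lra.
apply/ler_addgt0Pr => eps eps0.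
(* Small enough for [t <= 1], [t * C <= 1] and [t * expR a <= eps]. *)
pose t := Num.min (Num.min 1 (1 + C)^-1) (eps / expR a).
have C1 : 0 < 1 + C by lra.
have t0 : 0 < t by rewrite !lt_min ltr01 invr_gt0 C1 divr_gt0 ?expR_gt0.
have t1 : t <= 1 by rewrite !ge_min lexx.
have t2 : t <= (1 + C)^-1 by rewrite !ge_min lexx orbT.
have t3 : t <= eps / expR a by rewrite !ge_min lexx orbT.
apply: le_trans (key t t0 t1 _) _.
  by move: t2; rewrite -[_^-1]mul1r ler_pdivlMr//; lra.
by rewrite lerD2l -ler_pdivlMr ?expR_gt0.
Qed.

End generator.

(** * Disjoint regions progress independently *)

Section single_update.
Variables (R : realType) (q : R) (q1 : 1 <= q) (L : box).
Implicit Types (e : edges L) (z : labelling R L) (A B : set (labelling R L)).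

Lemma measurable_label e : measurable_fun setT (fun z : labelling R L => z e).
Proof.
move=> _ B mB; rewrite setTI; apply: sub_sigma_algebra.
by exists e, B.
Qed.

Lemma measurable_relabel e z :
  measurable_fun setT (fun u : measurableTypeR R => relabel e u z).
Proof.
apply: measurability; first exact: erefl.
move=> _ [_ [f [B [mB ->]]] <-]; rewrite setTI.
have [->|fe] := eqVneq f e.
  by rewrite (_ : _ @^-1` _ = B)//; apply/seteqP; split=> u /=; rewrite /relabel eqxx.
have [Bz|Bz] := pselect (B (z f)).
  rewrite (_ : _ @^-1` _ = setT)//; apply/seteqP; split=> u //= _.
  by rewrite /relabel (negbTE fe).
rewrite (_ : _ @^-1` _ = set0)//; apply/seteqP; split=> u //=.
by rewrite /relabel (negbTE fe).
Qed.

Definition update_prob e z A : R :=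
  fine (update_law q1 (threshold e z) [set u | A (relabel e u z)]).

Lemma measurable_update e z A : measurable A ->
  measurable [set u : measurableTypeR R | A (relabel e u z)].
Proof. by move=> mA; have := measurable_relabel e z measurableT mA; rewrite setTI. Qed.

Lemma update_probE e z A : measurable A ->
  (update_prob e z A)%:E =
  update_law q1 (threshold e z) [set u | A (relabel e u z)].
Proof. by move=> mA; rewrite fineK// fin_num_measure//; exact: measurable_update. Qed.

Lemma update_prob_le1 e z A : measurable A -> update_prob e z A <= 1.
Proof.
move=> mA; rewrite -lee_fin update_probE//; apply: probability_le1.
exact: measurable_update.
Qed.

Lemma update_prob_disj e z A B : measurable A -> measurable B ->
  A `&` B = set0 -> update_prob e z A <= 1 - update_prob e z B.
Proof.
move=> mA mB AB; rewrite lerBrDr -lee_fin EFinD !update_probE//.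
rewrite -measureU; last 3 first.
- exact: measurable_update.
- exact: measurable_update.
- by apply/seteqP; split=> u //= [Au Bu]; rewrite -[False]/(set0 (relabel e u z)) -AB.
by apply: probability_le1; apply: measurableU; exact: measurable_update.
Qed.

Lemma update_prob_set0 e z A : (forall u, ~ A (relabel e u z)) ->
  update_prob e z A = 0.
Proof.
move=> Az; rewrite /update_prob (_ : [set u | _] = set0) ?measure0//.
by apply/seteqP; split=> u //= /Az.
Qed.

Lemma update_prob_invariant e z A :
  (forall u, A (relabel e u z) <-> A z) -> update_prob e z A = \1_A z.
Proof.
move=> inv; rewrite indicE; have [Az|Az] := pselect (A z).
  rewrite mem_set// /update_prob (_ : [set u | _] = setT) ?probability_setT//.
  by apply/seteqP; split=> u //= _; apply/inv.
by rewrite memNset//; apply: update_prob_set0 => u /inv.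
Qed.

Lemma after_updates1E A z : measurable A ->
  after_updates q1 A 1 z = (\sum_(e : edges L) update_prob e z A)%:E.
Proof.
move=> mA; rewrite -sumEFin /=; apply: eq_bigr => e _; rewrite update_probE//.
rewrite -[X in update_law _ _ X]setIT -integral_indic//.
exact: measurable_update.
Qed.

End single_update.

Lemma integral_indic_sum d (T : measurableType d) (R : realType)
    (mu : probability T R) (J : Type) (s : seq J) (w : J -> R) (E : J -> set T) :
  (forall j, 0 <= w j) -> (forall j, measurable (E j)) ->
  (\int[mu]_z (\sum_(j <- s) w j * \1_(E j) z)%:E =
   (\sum_(j <- s) w j * fine (mu (E j)))%:E)%E.
Proof.
move=> w0 mE; have ind0 j z : 0 <= w j * (\1_(E j) z : R) by rewrite mulr_ge0.
under eq_integral do rewrite -sumEFin.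
rewrite ge0_integral_sum//; last 2 first.
- by move=> j; apply/measurable_EFinP/measurable_funM => //; exact: measurable_indic.
- by move=> j z _; rewrite lee_fin.
rewrite -sumEFin; apply: eq_bigr => j _.
under eq_integral do rewrite EFinM.
rewrite ge0_integralZl_EFin//; last first.
  by apply/measurable_EFinP; exact: measurable_indic.
by rewrite integral_indic// setIT EFinM fineK ?fin_num_measure.
Qed.

(** [D i k] is the event that the first [k] of the [depth i] steps of the scenario
    of region [i] hold; it depends on the labels in the region only, but the
    probability that the next step succeeds, bounded below by [c], may be that
    of an update law that depends on all the labels. *)
Section independent_regions.
Variables (R : realType) (q : R) (q1 : 1 <= q) (L : box).
Variables (I : finType) (region : I -> {set edges L}).
Variables (D : I -> nat -> set (labelling R L)) (depth : I -> nat) (n c : R).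
Hypothesis region_disj : forall i j e,
  e \in region i -> e \in region j -> i = j.
Hypothesis D0 : forall i z, D i 0 z.
Hypothesis mD : forall i k, measurable (D i k).
Hypothesis D_local : forall i k e u z, e \notin region i ->
  D i k (relabel e u z) <-> D i k z.
Hypothesis card_region : forall i, #|region i|%:R <= n.
Hypothesis c0 : 0 < c.
Hypothesis D_step : forall i k z, (k < depth i)%N -> D i k z ->
  exists2 e, e \in region i & c <= update_prob q1 e z (D i k.+1).

Let avoid (S : {set I}) (k : I -> nat) : set (labelling R L) :=
  [set z | forall i, i \in S -> ~ D i (k i) z].

Let lower (k : I -> nat) i : I -> nat := fun j => if j == i then (k i).-1 else k j.

Let measurable_avoid S k : measurable (avoid S k).
Proof.
rewrite (_ : avoid S k = \bigcap_(i in [set i | i \in S]) ~` D i (k i)).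
  by apply: fin_bigcap_measurable => // i _; exact: measurableC.
by apply/seteqP; split.
Qed.

Lemma measurable_avoid_regions S k : measurable (avoid S k).
Proof. exact: measurable_avoid. Qed.

Let avoid_update (S : {set I}) k i e u z : i \in S -> e \in region i ->
  avoid (S :\ i) k (relabel e u z) <-> avoid (S :\ i) k z.
Proof.
move=> iS ei; split=> H j jS; have := H j jS; move: jS; rewrite !inE => /andP[ji _].
all: have ej : e \notin region j
  by apply/negP => /(region_disj ei) ij; rewrite ij eqxx in ji.
all: by move=> + Dz; apply; apply/(D_local (k j) u z ej).
Qed.

(* The contribution of region [i] to the generator. Given that the other regions
   avoid their events, if region [i] has reached its event, at most [n] updates
   make it fail; if it is one step before, some update reaches it with
   probability at least [c]. *)
Let region_sum_le (S : {set I}) k i z : i \in S -> (0 < k i <= depth i)%N ->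
  \sum_(e in region i) (update_prob q1 e z (avoid S k) - \1_(avoid S k) z) <=
  n * (\1_(avoid (S :\ i) k) z - \1_(avoid S k) z) +
  c * (\1_(avoid S (lower k i)) z - \1_(avoid S k) z).
Proof.
move=> iS /andP[ki kh].
have n0 : 0 <= n by apply: le_trans (card_region i).
have sub k' : (forall j, j != i -> k' j = k j) -> avoid S k' `<=` avoid (S :\ i) k.
  by move=> kk y H j; rewrite !inE => /andP[ji jS]; rewrite -kk//; exact: H.
have [zi|zi] := pselect (avoid (S :\ i) k z); last first.
  have zA : ~ avoid S k z by move/(sub k (fun _ _ => erefl)).
  have zl : ~ avoid S (lower k i) z.
    by move=> h; apply: zi; apply: sub h => j /negbTE ji; rewrite /lower ji.
  rewrite !indicE !memNset// !subr0 !mulr0 addr0 big1// => e ei.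
  rewrite update_prob_set0 ?subr0// => u /(sub k (fun _ _ => erefl)).
  by rewrite (avoid_update k u z iS ei).
have [zD|zD] := pselect (D i (k i) z).
  have zA : ~ avoid S k z by move/(_ i iS).
  rewrite (indicE R (avoid (S :\ i) k)) (mem_set zi).
  rewrite (indicE R (avoid S k)) (memNset zA) !subr0 mulr1.
  apply: (@le_trans _ _ (\sum_(e in region i) 1)).
    by apply: ler_sum => e _; rewrite subr0 update_prob_le1.
  rewrite sumr_const (le_trans (card_region i))// lerDl mulr_ge0//; exact: ltW.
have zA : avoid S k z.
  move=> j jS; have [->//|ji] := eqVneq j i.
  by apply: zi; rewrite !inE ji.
rewrite (indicE R (avoid (S :\ i) k)) (mem_set zi).
rewrite (indicE R (avoid S k)) (mem_set zA) subrr mulr0 add0r.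
have le0 e : update_prob q1 e z (avoid S k) - 1 <= 0.
  by rewrite subr_le0 update_prob_le1.
have [zD1|zD1] := pselect (D i (k i).-1 z); last first.
  have zl : avoid S (lower k i) z.
    by move=> j jS; rewrite /lower; have [->|_] := eqVneq j i; last exact: zA.
  by rewrite indicE (mem_set zl) subrr mulr0; apply: sumr_le0 => e _.
have zl : ~ avoid S (lower k i) z by move=> /(_ i iS); rewrite /lower eqxx.
rewrite indicE (memNset zl) sub0r mulrN1.
have [|e ei ce] := D_step _ zD1; first by rewrite prednK.
rewrite prednK// in ce.
rewrite (bigD1 e)//= -[leRHS]addr0; apply: lerD; last exact: sumr_le0.
have : update_prob q1 e z (avoid S k) <= 1 - update_prob q1 e z (D i (k i)).
  by apply: update_prob_disj => //; apply/seteqP; split=> y //= [/(_ i iS)].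
lra.
Qed.

Let generator_avoid_le (S : {set I}) k z :
  (forall i, i \in S -> (0 < k i <= depth i)%N) ->
  \sum_e (update_prob q1 e z (avoid S k) - \1_(avoid S k) z) <=
  \sum_(i in S) (n * (\1_(avoid (S :\ i) k) z - \1_(avoid S k) z) +
  c * (\1_(avoid S (lower k i)) z - \1_(avoid S k) z)).
Proof.
move=> kS.
apply: le_trans (ler_sum _ (fun i iS => region_sum_le z iS (kS i iS))).
under [leRHS]eq_bigr do rewrite big_mkcond.
rewrite exchange_big/=; apply: ler_sum => e _.
have [/existsP[i /andP[iS ei]]|/existsPn eS] :=
    boolP [exists i, (i \in S) && (e \in region i)].
  rewrite (bigD1 i)//= ei big1 ?addr0// => j /andP[jS ji].
  by case: ifP => // /(region_disj ei) ij; rewrite ij eqxx in ji.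
rewrite big1; last by move=> i iS; have := eS i; rewrite iS/= => /negbTE ->.
rewrite update_prob_invariant ?subrr// => u.
by split=> H i iS; have := H i iS; have := eS i; rewrite iS/= => ei + h; apply;
  apply/(D_local (k i) u z ei).
Qed.

(* The solution of [(n + c) * miss k.+1 = n + c * miss k] with [miss 0 = 0]. *)
Let miss (k : nat) : R := 1 - (c / (n + c)) ^+ k.

(** The recursion on [mu (avoid S k)] is obtained from the generator applied to
    the event [avoid S k] itself, and solved by induction on the sum of the
    [k i + 1]: both removing [i] from [S] and lowering [k i] decrease it. *)
Lemma avoid_regions_le (mu : probability (labelling R L) R)
    (hmu : invariant_measure q1 mu) (S : {set I}) (k : I -> nat) :
  (forall i, i \in S -> (k i <= depth i)%N) ->
  fine (mu (avoid S k)) <= \prod_(i in S) miss (k i).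
Proof.
move: {-1}(\sum_(i in S) (k i).+1)%N (leqnn (\sum_(i in S) (k i).+1)) => s.
elim: s S k => [|s IH] S k sS kS.
  have -> : S = finset.set0.
    apply/eqP/set0Pn => -[i iS].
    by move: sS; rewrite (bigD1 i)//= leqn0 addn_eq0.
  by rewrite big_set0 -lee_fin fineK ?fin_num_measure// probability_le1.
have [->|/set0Pn[i0 i0S]] := eqVneq S finset.set0.
  by rewrite big_set0 -lee_fin fineK ?fin_num_measure// probability_le1.
have n0 : 0 <= n by apply: le_trans (card_region i0).
have nc0 : 0 < n + c by rewrite ltr_wpDl.
have x01 : 0 <= c / (n + c) <= 1.
  apply/andP; split; first by rewrite divr_ge0// ltW.
  by rewrite ler_pdivrMr// mul1r lerDr.
have miss0 j : 0 <= miss j by case/andP: x01 => x0 x1; rewrite subr_ge0 exprn_ile1.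
have [/existsP[i /andP[iS /eqP ki]]|/existsPn k_gt0] :=
    boolP [exists i, (i \in S) && (k i == 0%N)].
  rewrite (_ : avoid S k = set0) ?measure0 ?prodr_ge0//.
  by apply/seteqP; split=> z //= /(_ i iS); rewrite ki; apply; exact: D0.
have kS' i : i \in S -> (0 < k i <= depth i)%N.
  by move=> iS; rewrite kS// andbT lt0n; have := k_gt0 i; rewrite iS.
set A := avoid S k; set P := \prod_(i in S) miss (k i).
pose B i := avoid (S :\ i) k; pose B' i := avoid S (lower k i).
pose Q i := \prod_(j in S :\ i) miss (k j).
have PQ i : i \in S -> P = miss (k i) * Q i.
  by move=> iS; rewrite /P (big_setD1 i).
have hB i : i \in S -> fine (mu (B i)) <= Q i.
  move=> iS; apply: IH => [|j]; last by rewrite !inE => /andP[_ /kS].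
  by move: sS; rewrite (big_setD1 i)//=; lia.
have hB' i : i \in S -> fine (mu (B' i)) <= miss (k i).-1 * Q i.
  move=> iS; have /andP[ki kh] := kS' i iS.
  apply: le_trans (IH S (lower k i) _ _) _.
  - move: sS; rewrite !(big_setD1 i iS)/= {1}/lower eqxx prednK//.
    have -> : (\sum_(j in S :\ i) (lower k i j).+1 = \sum_(j in S :\ i) (k j).+1)%N.
      by apply: eq_bigr => j; rewrite !inE /lower => /andP[/negbTE ->].
    by move: ki; case: (k i) => //=; lia.
  - move=> j jS; rewrite /lower; case: eqP => [->|_]; last exact: kS.
    by rewrite (leq_trans (leq_pred _)).
  rewrite (big_setD1 i iS)/= {1}/lower eqxx ler_wpM2l//.
  rewrite le_eqVlt; apply/orP; left; apply/eqP; apply: eq_bigr => j.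
  by rewrite !inE /lower => /andP[/negbTE ->].
pose a := #|{: edges L}|%:R : R.
have c0' := ltW c0.
(* The bound on the generator, as one sum of weighted indicator functions: the
   index [None] stands for [A] itself. *)
pose w (j : option (I + I)) :=
  match j with None => a | Some (inl _) => n | Some (inr _) => c end.
pose E (j : option (I + I)) :=
  match j with None => A | Some (inl i) => B i | Some (inr i) => B' i end.
pose l := None :: [seq Some (inl i) | i <- enum S] ++ [seq Some (inr i) | i <- enum S].
have sumE (f : option (I + I) -> R) : \sum_(j <- l) f j =
    f None + \sum_(i in S) (f (Some (inl i)) + f (Some (inr i))).
  by rewrite big_cons big_cat !big_map /= !big_enum -big_split.
have w0 j : 0 <= w j by case: j => [[]|].
have mE j : measurable (E j) by case: j => [[i|i]|]; exact: measurable_avoid.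
have mA : measurable A by exact: measurable_avoid.
have ind0 (F : set (labelling R L)) z : 0 <= (\1_F z : R) by [].
have := invariant_generator_le hmu mA (C := #|S|%:R * (n + c)) _ _ _
   (integral_indic_sum mu l w0 mE).
rewrite !sumE => key.
have {key} : (a + #|S|%:R * (n + c)) * fine (mu A) <= a * fine (mu A) +
    \sum_(i in S) (n * fine (mu (B i)) + c * fine (mu (B' i))).
  apply: key.
  - by rewrite mulr_ge0// ltW.
  - apply: measurable_sum => j; apply: measurable_funM => //; exact: measurable_indic.
  - by move=> z; apply: sumr_ge0 => j _; rewrite mulr_ge0.
  move=> z; rewrite after_updates1E// lee_fin sumE/=.
  have := generator_avoid_le z kS'; rewrite -/A sumrB sumr_const -[_ *+ _]mulr_natl -/a.
  have -> : \sum_(i in S) (n * (\1_(B i) z - \1_A z) + c * (\1_(B' i) z - \1_A z)) =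
      \sum_(i in S) (n * \1_(B i) z + c * \1_(B' i) z) -
      #|S|%:R * (n + c) * \1_A z.
    rewrite -[_ * _ * _]mulrA [#|S|%:R * _]mulr_natl -sumr_const -sumrB.
    by apply: eq_bigr => i _; ring.
  by move=> h; lra.
rewrite mulrDl lerD2l => h.
have : #|S|%:R * (n + c) * fine (mu A) <= #|S|%:R * (n + c) * P.
  apply: le_trans h _; rewrite -mulrA [leRHS]mulr_natl -sumr_const.
  apply: ler_sum => i iS; rewrite (PQ i iS).
  apply: le_trans (lerD (ler_wpM2l n0 (hB i iS)) (ler_wpM2l c0' (hB' i iS))) _.
  have /andP[ki _] := kS' i iS.
  rewrite /miss -{2}(prednK ki) exprS.
  have cE : (n + c) * (c / (n + c)) = c by rewrite mulrC divfK// gt_eqF.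
  rewrite le_eqVlt; apply/orP; left; apply/eqP.
  move: (c / (n + c)) cE => x cE; set y := x ^+ _.
  have -> : (n + c) * ((1 - x * y) * Q i) =
      (n + c) * Q i - (n + c) * x * y * Q i by ring.
  by rewrite cE; ring.
by rewrite ler_pM2l// mulr_gt0// ltr0n card_gt0; apply/set0Pn; exists i0.
Qed.

End independent_regions.

(** * The law of a new label *)

Section update_law_bounds.
Variables (R : realType) (q : R) (q1 : 1 < q).
Local Notation law T := (update_law (ltW q1) T).
(* The distribution function of the new label below the threshold. *)
Local Notation slow p := (p / (p + (1 - p) * q)).

Let den_ge1 (p : R) : p <= 1 -> 1 <= p + (1 - p) * q.
Proof.
move=> p1; have : 0 <= (1 - p) * (q - 1) by rewrite mulr_ge0 ?subr_ge0// ltW.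
by lra.
Qed.

Let slow_le (p s : R) : 0 <= p -> p <= s -> s <= 1 -> slow p <= slow s.
Proof.
move=> p0 ps s1; have dp := den_ge1 (le_trans ps s1); have ds := den_ge1 s1.
rewrite ler_pdivrMr; last by lra.
rewrite mulrAC ler_pdivlMr; last by lra.
have := ler_wpM2r (ltW (lt_trans ltr01 q1)) ps.
by lra.
Qed.

Let slow_le_id (p : R) : 0 <= p <= 1 -> slow p <= p.
Proof.
have hq := q1.
move=> /andP[p0 p1]; have d := den_ge1 p1.
by rewrite ler_pdivrMr; [nra|lra].
Qed.

Lemma update_law_itvNy T (p : R) : 0 <= p <= 1 ->
  fine (law T [set u | u <= p]) = update_df q T p.
Proof.
have hq := q1.
move=> p01; have := update_lawE (ltW q1) T p01.
rewrite (_ : `]-oo, p]%classic = [set u | u <= p]) => [->//|].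
by apply/seteqP; split=> u /=; rewrite in_itv.
Qed.

Let update_df_le T (p : R) : 0 <= p <= 1 -> update_df q T p <= p.
Proof.
by move=> p01; rewrite /update_df; case: ifP => // _; exact: slow_le_id. Qed.

Let mle (p : R) : measurable [set u : measurableTypeR R | u <= p].
Proof.
have hq := q1.
rewrite (_ : [set u | _] = `]-oo, p]%classic); first exact: measurable_itv.
by apply/seteqP; split=> u /=; rewrite in_itv.
Qed.

Lemma update_law_low T : (1 + 2 * q)^-1 <= fine (law T [set u | u <= 3^-1]).
Proof.
have hq := q1.
rewrite update_law_itvNy; last by lra.
have -> : (1 + 2 * q)^-1 = slow (3^-1 : R) by field; rewrite gt_eqF//; lra.
by rewrite /update_df; case: ifP => // _; apply: slow_le_id; lra.
Qed.

Lemma update_law_high T (p : R) : 0 <= p <= 1 ->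
  1 - p <= fine (law T [set u | p < u]).
Proof.
have hq := q1.
move=> p01; have := update_df_le T p01; rewrite -update_law_itvNy// => h.
have -> : [set u | p < u] = ~` [set u : measurableTypeR R | u <= p].
  by apply/seteqP; split=> u /=; rewrite ltNge => /negP.
rewrite probability_setC// fineB// ?fin_num_measure//= lerD2l lerN2. exact: h.
Qed.

Let update_law_itv T (s p : R) : 0 <= s -> s <= p -> p <= 1 ->
  fine (law T [set u | s < u <= p]) = update_df q T p - update_df q T s.
Proof.
have hq := q1.
move=> s0 sp p1; rewrite -!update_law_itvNy; [|lra..].
have -> : [set u | s < u <= p] =
    [set u : measurableTypeR R | u <= p] `\` [set u | u <= s].
  apply/seteqP; split=> u /=; first by rewrite ltNge => /andP[/negP].
  by move=> [-> /negP]; rewrite -ltNge => ->.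
rewrite measureD// ?setIidr//.
- by rewrite fineB// fin_num_measure.
- by move=> u /= us; exact: le_trans sp.
- by rewrite -ge0_fin_numE// fin_num_measure.
Qed.

Lemma update_law_mid T :
  (1 + 2 * q)^-1 <= fine (law T [set u | 3^-1 < u <= 2 / 3]).
Proof.
have hq := q1.
rewrite update_law_itv; [|lra..].
have e1 : slow (3^-1 : R) = (1 + 2 * q)^-1 by field; rewrite gt_eqF//; lra.
have e2 : slow (2 / 3 : R) = 2 / (2 + q) by field; rewrite gt_eqF//; lra.
have i1 : (1 + 2 * q)^-1 <= 3^-1 by rewrite lef_pV2 ?posrE; lra.
rewrite /update_df e1 e2; case: (leP T 3^-1) => T1.
  by rewrite ifT; lra.
case: ifP => _; first lra.
rewrite lerBrDr -mulr2n -[_ *+ 2]mulr_natl ler_pdivrMr; last by lra.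
by rewrite mulrAC ler_pdivlMr; lra.
Qed.

(** The distribution function jumps at [T] from [T / (T + (1 - T) q)] to [T], that
    is by [T (1 - T) (q - 1) / (T + (1 - T) q)]; here [T (1 - T) >= 2 / 9] and
    the denominator is at most [q]. *)
Lemma update_law_atom (T : R) : 3^-1 < T -> T <= 2 / 3 ->
  (q - 1) / (9 * q) <= fine (law T [set T]).
Proof.
have hq := q1.
move=> T0 T1.
pose O := [set u : measurableTypeR R | 0 < u < T].
have OE : O = `]0, T[%classic by apply/seteqP; split=> u /=; rewrite in_itv.
have mO : measurable O by rewrite OE; exact: measurable_itv.
have lO : fine (law T O) <= slow T.
  rewrite -lee_fin fineK ?fin_num_measure// OE itv_bnd_open_bigcup.
  have mF n : measurable (`]0, (T - n.+1%:R^-1)]%classic : set (measurableTypeR R)).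
    exact: measurable_itv.
  have ndF : nondecreasing_seq
      (fun n => `]0, (T - n.+1%:R^-1)]%classic : set (measurableTypeR R)).
    move=> n m nm; apply/subsetPset => u /=; rewrite !in_itv/= => /andP[-> /le_trans]; apply.
    by rewrite lerD2l lerN2 lef_pV2 ?posrE// ler_nat.
  have cF := @nondecreasing_cvg_mu _ _ _ (law T) _ mF (bigcupT_measurable _ mF) ndF.
  rewrite -(cvg_lim _ cF)//; apply: lime_le; first by apply/cvg_ex; eexists; exact: cF.
  apply: nearW => n /=.
  pose p := Num.max 0 (T - n.+1%:R^-1).
  have p0 : 0 <= p by rewrite le_max lexx.
  have pT : p < T by rewrite gt_max; apply/andP; split; [lra|rewrite ltrBlDr ltrDl invr_gt0].
  have p01 : 0 <= p <= 1 by lra.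
  apply: (@le_trans _ _ (law T [set u | u <= p])).
    apply: le_measure; rewrite ?inE//.
    by move=> u /=; rewrite in_itv/= => /andP[_ up]; rewrite le_max up orbT.
  rewrite -[X in (X <= _)%E]fineK ?fin_num_measure// update_law_itvNy// lee_fin.
  rewrite /update_df ifF; last by apply/negbTE; rewrite -ltNge.
  by apply: slow_le; [|exact: ltW|lra].
have lT : fine (law T [set u | 0 < u <= T]) = T.
  rewrite update_law_itv; [|lra..].
  by rewrite /update_df lexx ifF ?mul0r ?subr0//; apply/negbTE; rewrite -ltNge; lra.
have : fine (law T [set u | 0 < u <= T]) = fine (law T O) + fine (law T [set T]).
  rewrite -fineD ?fin_num_measure//.
  congr fine; rewrite -measureU//; last first.
    by apply/seteqP; split=> u //= -[/andP[_ +] uT]; rewrite uT ltxx.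
  congr (law T _); apply/seteqP; split=> u /=.
    by rewrite /O/= le_eqVlt => /andP[-> /orP[/eqP|]]; [right|left].
  by case=> [/andP[-> /ltW]//|->]; rewrite lexx andbT; lra.
rewrite lT => TE.
have : (q - 1) / (9 * q) <= T - slow T; last by lra.
have d0 : 0 < T + (1 - T) * q by nra.
have -> : T - slow T = T * (1 - T) * (q - 1) / (T + (1 - T) * q) by field; lra.
rewrite ler_pdivrMr; last by lra.
rewrite mulrAC ler_pdivlMr//.
have TT : 2 / 9 <= T * (1 - T).
  have : 0 <= (T - 3^-1) * (2 / 3 - T) by rewrite mulr_ge0 ?subr_ge0// ltW.
  by lra.
have hd : T + (1 - T) * q <= T * (1 - T) * (9 * q).
  have : 2 / 9 * (9 * q) <= T * (1 - T) * (9 * q) by rewrite ler_wpM2r//; lra.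
  have : 0 <= T * (q - 1) by rewrite mulr_ge0//; lra.
  by lra.
have q10 : 0 <= q - 1 by lra.
have := ler_wpM2l q10 hd; lra.
Qed.

End update_law_bounds.

(** * The threshold of a rung of a ladder *)

Section walks.
Variables (T : eqType) (r : rel T).

Definition walk (a b : T) : Prop := exists s, path r a s /\ last a s = b.

Lemma walk_refl a : walk a a.
Proof. by exists [::]. Qed.

Lemma walk_step a b : r a b -> walk a b.
Proof. by move=> ab; exists [:: b]; rewrite /= ab. Qed.

Lemma walk_trans a b d : walk a b -> walk b d -> walk a d.
Proof.
move=> [s [ps <-]] [t [pt <-]]; exists (s ++ t).
by rewrite cat_path ps pt last_cat.
Qed.

Lemma walk_exit (A : pred T) a b : walk a b -> A a -> ~~ A b ->
  exists u v, [/\ r u v, A u & ~~ A v].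
Proof.
move=> [s [ps <-]]; elim: s a ps => [|v s IH] a /=; first by move=> _ ->.
move=> /andP[av vs] Aa nA; have [Av|nAv] := boolP (A v); first exact: IH nA.
by exists a, v.
Qed.

End walks.

Section ladder.
Variables (x : int) (N : nat).

Definition bottom_row : pred site :=
  fun v => [&& v.2 == 0, x <= v.1 & v.1 < x + N%:Z].

Definition crossing (e : lattice_edge) : bool :=
  bottom_row (edge_src e) (+) bottom_row (edge_tgt e).

Definition rung (i : nat) : lattice_edge := ((x + i%:Z, 0), true).

Definition rungs : seq lattice_edge := [seq rung i | i <- iota 0 N].

Definition rails : seq lattice_edge :=
  [seq ((x + i%:Z, j), false) | i <- iota 0 N.-1, j <- [:: 0; 1]].

(** An enumeration of the edges with exactly one endpoint in the bottom row, used
    to bound their number; see [mem_cut_edges]. *)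
Definition cut_edges : seq lattice_edge :=
  [seq ((x + i%:Z, j), true) | i <- iota 0 N, j <- [:: 0; -1]] ++
  [:: ((x - 1, 0), false); ((x + N%:Z - 1, 0), false)].

Lemma mem_rungs e : (e \in rungs) =
  [&& e.2, e.1.2 == 0, x <= e.1.1 & e.1.1 < x + N%:Z].
Proof.
case: e => [[a b] d]; apply/mapP/idP => [[i]|/=].
  by rewrite mem_iota => iN [-> -> ->] /=; lia.
case: d => //= /and3P[/eqP -> xa aN]; exists `|a - x|%N; first by rewrite mem_iota; lia.
by congr (_, _, _); rewrite /=; lia.
Qed.

Lemma mem_rails e : (e \in rails) =
  [&& ~~ e.2, (e.1.2 == 0) || (e.1.2 == 1), x <= e.1.1 & e.1.1 + 1 < x + N%:Z].
Proof.
case: e => [[a b] d]; apply/allpairsP/idP => [[[i j] /= []]|/=].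
  by rewrite mem_iota !inE => iN j01 [-> -> ->] /=; lia.
case: d => //= /and3P[b01 xa aN]; exists (`|a - x|%N, b); split => /=.
- by rewrite mem_iota; lia.
- by rewrite !inE.
- by congr (_, _, _); rewrite /=; lia.
Qed.

Lemma mem_cut_edges e : (0 < N)%N -> (e \in cut_edges) = crossing e.
Proof.
move=> N0; case: e => [[a b] d]; rewrite /cut_edges mem_cat.
rewrite /crossing /bottom_row /edge_src /edge_tgt /=.
have -> : (((a, b), d) \in [seq ((x + i%:Z, j), true) | i <- iota 0 N, j <- [:: 0; -1]]) =
   [&& d, (b == 0) || (b == -1), x <= a & a < x + N%:Z].
  apply/allpairsP/idP => [[[i j] /= []]|/=].
    by rewrite mem_iota !inE => iN j01 [-> -> ->] /=; lia.
  case: d => //= /and3P[b01 xa aN]; exists (`|a - x|%N, b); split => /=.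
  - by rewrite mem_iota; lia.
  - by rewrite !inE.
  - by congr (_, _, _); rewrite /=; lia.
by rewrite !inE !xpair_eqE; case: d => /=; lia.
Qed.

Lemma rungs_crossing e : e \in rungs -> crossing e.
Proof.
rewrite mem_rungs /crossing /bottom_row /edge_src /edge_tgt.
by case: e => [[a b] []] /=; lia.
Qed.

Lemma rails_not_crossing e : e \in rails -> ~~ crossing e.
Proof.
rewrite mem_rails /crossing /bottom_row /edge_src /edge_tgt.
by case: e => [[a b] []] /=; lia.
Qed.

End ladder.

Section threshold_of_rung.
Variables (R : realType) (L : box) (x : int) (N : nat).
Variables (r0 e : edges L) (i : nat) (z : labelling R L).
Hypothesis r0E : val r0 = rung x 0.
Hypothesis eE : val e = rung x i.
Hypothesis i0 : (0 < i < N)%N.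
Hypothesis rails_in : forall f, f \in rails x N -> f \in edges L.
Hypothesis r0_mid : 3^-1 < z r0 <= 2 / 3.
Hypothesis rails_low : forall f : edges L, val f \in rails x N -> z f <= 3^-1.
Hypothesis cut_above : forall f : edges L, crossing x N (val f) -> f != r0 -> z r0 <= z f.

Let r := open_step (omega (z r0) z) e.

Let rail_step (k : nat) (j : int) : (j == 0) || (j == 1) -> (k.+1 < N)%N ->
  r (x + k%:Z, j) (x + k.+1%:Z, j) && r (x + k.+1%:Z, j) (x + k%:Z, j).
Proof.
move=> j01 kN.
have rf : ((x + k%:Z, j), false) \in rails x N by rewrite mem_rails /= j01; lia.
pose f : edges L := [` rails_in rf]%fset.
have zf : omega (z r0) z f.
  by rewrite /omega; apply: le_trans (rails_low _) _ => //; case/andP: r0_mid => /ltW.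
have fe : f != e by rewrite -val_eqE eE /= xpair_eqE andbF.
have xk : x + k.+1%:Z = x + k%:Z + 1 by lia.
by apply/andP; split; apply/existsP; exists f; 
  rewrite fe zf /joins /edge_src /edge_tgt /= xk !eqxx ?orbT.
Qed.

Let linked_at_r0 : linked_off e (omega (z r0) z).
Proof.
rewrite /linked_off eE /edge_src /edge_tgt /= add0r -/(walk _ _ _) -/r.
have left (k : nat) : (k < N)%N -> walk r (x + k%:Z, 0) (x, 0).
  elim: k => [|k IH] kN; first by rewrite addr0; exact: walk_refl.
  apply: walk_trans (IH (ltnW kN)); apply: walk_step.
  by have /andP[] := @rail_step k 0 isT kN.
have right (k : nat) : (k < N)%N -> walk r (x, 1) (x + k%:Z, 1).
  elim: k => [|k IH] kN; first by rewrite addr0; exact: walk_refl.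
  apply: walk_trans (IH (ltnW kN)) _; apply: walk_step.
  by have /andP[] := @rail_step k 1 isT kN.
have up : walk r (x, 0) (x, 1).
  apply: walk_step; apply/existsP; exists r0; rewrite /omega lexx r0E.
  rewrite /joins /edge_src /edge_tgt /rung /= addr0 add0r !eqxx !andbT.
  by rewrite -val_eqE r0E eE /rung /= !xpair_eqE; lia.
have /andP[_ iN] := i0.
exact: walk_trans (left i iN) (walk_trans up (right i iN)).
Qed.

(** A path that joins the ends of the rung [e] off [e] leaves the bottom row
    through another edge of the cut, whose label is at least [z r0]; and the
    path along the rails through [r0] attains this level. *)
Lemma threshold_rung : threshold e z = z r0.
Proof.
have r01 : 0 <= z r0 <= 1 by have := r0_mid; lra.
have mem : linking_levels e z (z r0) by split => //; exact: linked_at_r0.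
have lb p : linking_levels e z p -> z r0 <= p.
  move=> [_ walk_p].
  have [u [v []]] : exists u v,
      [/\ open_step (omega p z) e u v, bottom_row x N u & ~~ bottom_row x N v].
    apply: (walk_exit (A := bottom_row x N)) walk_p _ _;
      rewrite eE /bottom_row /rung /edge_src /edge_tgt /=; lia.
  move=> /existsP[f /and3P[fe zf uv]] Au Av.
  have cf : crossing x N (val f).
    move: uv; rewrite /joins /crossing.
    by move=> /orP[] /andP[/eqP <- /eqP <-]; rewrite Au (negbTE Av).
  have [fr|fr] := eqVneq f r0; first by rewrite -fr.
  by apply: le_trans zf; exact: cut_above.
rewrite /threshold ifF; last by apply/negbTE/eqP => E0; rewrite E0 in mem.
apply/eqP; rewrite eq_le; apply/andP; split.
  by apply: ge_inf => //; exists (z r0) => p; exact: lb.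
by apply: lb_le_inf => //; exists (z r0).
Qed.

End threshold_of_rung.

(** * The scenario that creates a cloud *)

(** What a step of the scenario demands of the label of an edge, the first rung
    being the reference for the last two kinds. *)
Inductive demand := InMiddle | IsLow | AboveFirst | EqualFirst.

(** The order in which the demands are met; no demand of smaller or equal rank is
    spoilt by the update that meets a new one. *)
Definition rank (d : demand) : nat :=
  match d with InMiddle => 0 | IsLow => 1 | AboveFirst => 2 | EqualFirst => 3 end.

Definition unrank (n : nat) : demand :=
  match n with 0 => InMiddle | 1 => IsLow | 2 => AboveFirst | _ => EqualFirst end.

Lemma rankK : cancel rank unrank. Proof. by case. Qed.

HB.instance Definition _ := Equality.copy demand (can_type rankK).

Section script.
Variables (R : realType) (L : box) (x : int) (N : nat) (r0 : edges L).
Hypothesis N0 : (0 < N)%N.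
Hypothesis r0E : val r0 = rung x 0.
Hypothesis rungs_in : forall f, f \in rungs x N -> f \in edges L.
Hypothesis rails_in : forall f, f \in rails x N -> f \in edges L.
Local Notation step := (edges L * demand)%type.

Definition meets (z : labelling R L) (s : step) : bool :=
  match s.2 with
  | InMiddle => 3^-1 < z s.1 <= 2 / 3
  | IsLow => z s.1 <= 3^-1
  | AboveFirst => z r0 <= z s.1
  | EqualFirst => z s.1 == z r0
  end.

Definition in_box (l : seq lattice_edge) : seq (edges L) := pmap insub l.

Definition but_first (l : seq (edges L)) := [seq e <- l | e != r0].

(** A rung other than the first one occurs twice: its label is first raised to at
    least that of the first rung, which makes it harmless for the threshold of
    the other rungs, and then updated to the common value. *)
Definition script : seq step :=
  (r0, InMiddle) :: [seq (e, IsLow) | e <- in_box (rails x N)] ++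
  [seq (e, AboveFirst) | e <- but_first (in_box (cut_edges x N))] ++
  [seq (e, EqualFirst) | e <- but_first (in_box (rungs x N))].

Let mem_tag (e : edges L) (d d' : demand) (l : seq (edges L)) :
  ((e, d) \in [seq (f, d') | f <- l]) = (d == d') && (e \in l).
Proof.
apply/mapP/andP => [[f fl [-> ->]]|[/eqP -> el]]; first by rewrite eqxx.
by exists e.
Qed.

Lemma mem_script (s : step) : (s \in script) =
  match s.2 with
  | InMiddle => s.1 == r0
  | IsLow => val s.1 \in rails x N
  | AboveFirst => (s.1 != r0) && crossing x N (val s.1)
  | EqualFirst => (s.1 != r0) && (val s.1 \in rungs x N)
  end.
Proof.
case: s => e d; rewrite in_cons !mem_cat !mem_tag !mem_filter !mem_pmap_sub.
by rewrite -(mem_cut_edges _ _ N0) xpair_eqE; case: d => /=; rewrite ?andbT ?andbF ?orbF.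
Qed.

Lemma script_ordered : pairwise (fun s t : step => rank s.2 <= rank t.2)%N script.
Proof.
have tagged (d d' : demand) l l' : (rank d <= rank d')%N ->
    allrel (fun s t : step => rank s.2 <= rank t.2)%N
      [seq (e, d) | e <- l] [seq (e, d') | e <- l'].
  by move=> dd; apply/allrelP => s t /mapP[e _ ->] /mapP[f _ ->].
have tagged1 (d : demand) l :
    pairwise (fun s t : step => rank s.2 <= rank t.2)%N [seq (e, d) | e <- l].
  rewrite pairwise_map; elim: l => //= e l ->; rewrite andbT; apply/allP => f _ /=.
  exact: leqnn.
rewrite /script pairwise_cons !pairwise_cat allrel_catr !tagged// !tagged1 !andbT.
by apply/allP.
Qed.

Lemma size_script : (size script <= 5 * N + 3)%N.
Proof.
have sub l : (size (in_box l) <= size l)%N by rewrite size_pmap_sub count_size.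
have sub1 l : (size (but_first (in_box l)) <= size l)%N.
  by rewrite size_filter (leq_trans (count_size _ _)).
rewrite /= !size_cat !size_map.
have := sub (rails x N); have := sub1 (cut_edges x N); have := sub1 (rungs x N).
rewrite /rails /cut_edges /rungs size_cat !size_allpairs !size_map !size_iota /=; lia.
Qed.

Definition script_edges : {set edges L} := [set e in map fst script].

Lemma card_script_edges : (#|script_edges| <= 5 * N + 3)%N.
Proof.
have card_le (l : seq (edges L)) : (#|finset (fun e => e \in l)| <= size l)%N.
  by rewrite cardsE card_size.
apply: leq_trans (card_le _) _.
by rewrite size_map size_script.
Qed.

Lemma script_edgeP e : e \in script_edges -> exists d, (e, d) \in script.
Proof. by rewrite inE => /mapP[[f d] fs ->]; exists d. Qed.

Definition progress (k : nat) : set (labelling R L) :=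
  [set z | all (meets z) (take k script)].

Lemma measurable_meets s : measurable [set z | meets z s].
Proof.
have mb (b : labelling R L -> bool) : measurable_fun setT b -> measurable [set z | b z].
  move=> mb; have := mb measurableT [set true] I; rewrite setTI.
  by congr measurable; apply/seteqP; split=> z /=.
have ml e := @measurable_label R L e.
have mc (c : R) : measurable_fun setT (fun _ : labelling R L => c) by exact: measurable_cst.
apply: mb; case: s => e [] /=; rewrite /meets /=.
- by apply: measurable_and; [exact: measurable_fun_ltr|exact: measurable_fun_ler].
- exact: measurable_fun_ler.
- exact: measurable_fun_ler.
- exact: measurable_fun_eqr.
Qed.

Lemma measurable_progress k : measurable (progress k).
Proof.
rewrite /progress; elim: (take k script) => [|s l IH] /=.
  by rewrite (_ : [set z | true] = setT)//; apply/seteqP.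
rewrite (_ : [set z | _] = [set z | meets z s] `&` [set z | all (meets z) l]).
  by apply: measurableI => //; exact: measurable_meets.
by apply/seteqP; split=> z /andP.
Qed.

Lemma meets_relabel e u z (s : step) : s \in script -> e \notin script_edges ->
  meets (relabel e u z) s = meets z s.
Proof.
move=> ss eS.
have neq t : t \in script -> (t.1 == e) = false.
  move=> ts; apply/negbTE/eqP => te; move: eS; rewrite inE -te => /negP; apply.
  exact: map_f.
have := neq _ (mem_head _ _ : (r0, InMiddle) \in script).
by have := neq _ ss; rewrite /meets /relabel /= => -> ->.
Qed.

Lemma progress_local k e u z : e \notin script_edges ->
  progress k (relabel e u z) <-> progress k z.
Proof.
move=> eS; rewrite /progress /= (@eq_in_all _ _ (meets z))// => s /mem_take ss.
exact: meets_relabel.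
Qed.

Lemma progress_large_cloud z : progress (size script) z -> large_cloud N z.
Proof.
move=> Dz; have all_met s : s \in script -> meets z s.
  by apply/allP; rewrite -[X in all _ X]take_size; exact: Dz.
have := all_met (r0, InMiddle); rewrite mem_head /meets /= => /(_ isT) r0_mid.
exists (z r0); split; first by lra.
have urungs : uniq (rungs x N).
  by rewrite map_inj_uniq ?iota_uniq// => i j [] /addrI [].
have <- : size (in_box (rungs x N)) = N.
  transitivity (size (rungs x N)); last by rewrite size_map size_iota.
  by apply/eqP; rewrite size_pmap_sub -all_count; apply/allP => f /rungs_in.
rewrite -(card_uniqP (pmap_sub_uniq _ urungs)).
apply/subset_leq_card/fintype.subsetP => e; rewrite mem_pmap_sub inE => er.
have [->//|er0] := eqVneq e r0.
have := all_met (e, EqualFirst); rewrite mem_script /= er0 er => /(_ isT).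
by rewrite /meets.
Qed.

Section one_more_step.
Variables (q : R) (q1 : 1 < q).

(** The first bound is for the atom, the second one for the other steps. *)
Definition step_prob : R := Num.min ((q - 1) / (9 * q)) (1 + 2 * q)^-1.

Lemma step_prob_gt0 : 0 < step_prob.
Proof.
have hq := q1.
by rewrite lt_min divr_gt0 ?invr_gt0; lra.
Qed.

(** The next step of the script is performed by updating its edge. The demands met
    before survive: those on other edges are not concerned, as the first rung is
    only updated at the very beginning, and a demand on the same edge has a
    smaller rank and is implied by the new one. The last kind of demand is met
    by the atom of the law of the new label. *)
Lemma progress_step k z : (k < size script)%N -> progress k z ->
  exists2 e, e \in script_edges &
    step_prob <= update_prob (ltW q1) e z (progress k.+1).
Proof.
have hq := q1 => ks Dz.
pose s := nth (r0, InMiddle) script k; pose pre := take k script.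
have scriptE : script = pre ++ s :: drop k.+1 script.
  by rewrite -drop_nth// cat_take_drop.
have ss : s \in script by exact: mem_nth.
have := script_ordered; rewrite {1}scriptE pairwise_cat pairwise_cons.
move=> /and4P[/allrelP pre_le _ /allP post_ge _].
have pre_rank t : t \in pre -> (rank t.2 <= rank s.2)%N.
  by move=> tp; apply: pre_le => //; exact: mem_head.
have pre_script t : t \in pre -> t \in script by exact: mem_take.
have earlier t : t \in script -> (rank t.2 < rank s.2)%N -> t \in pre.
  rewrite scriptE mem_cat in_cons => /or3P[//|/eqP ->|tp]; first by rewrite ltnn.
  by rewrite ltnNge post_ge.
have met t : t \in pre -> meets z t by apply/allP.
have r0_cross : crossing x N (val r0).
  by apply: rungs_crossing; rewrite r0E mem_rungs /=; lia.
have e_r0 : s.2 != InMiddle -> s.1 != r0.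
  move: ss; rewrite mem_script; case: s.2 => // [er _|/andP[]//|/andP[]//].
  by apply: contraL er => /eqP ->; apply: contraL r0_cross; exact: rails_not_crossing.
have keep u t : t \in pre -> meets (relabel s.1 u z) s -> meets (relabel s.1 u z) t.
  move=> tp; have := pre_rank t tp; have := met t tp.
  have := pre_script t tp; have := e_r0; move: ss; rewrite !mem_script /meets /relabel.
  case: (s) => e d; case: t {tp} => f d'; rewrite /=.
  case: d => [/eqP -> _|er /(_ isT) e0|/andP[_ ec] /(_ isT) e0|/andP[_ er] /(_ isT) e0].
  - by case: d' => //= /eqP ->.
  - rewrite [r0 == e]eq_sym (negbTE e0); have [->|fe] := eqVneq f e; last by case: d'.
    by case: d' => //=; [move=> /(negP e0)|rewrite eqxx].
  - rewrite [r0 == e]eq_sym (negbTE e0); have [->|fe] := eqVneq f e; last by case: d'.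
    case: d' => //=; rewrite ?eqxx//; first by move=> /(negP e0).
    by move=> /rails_not_crossing; rewrite ec.
  rewrite [r0 == e]eq_sym (negbTE e0); have [->|fe] := eqVneq f e; last by case: d'.
  case: d' => //=; rewrite ?eqxx//; first by move=> /(negP e0).
    by move=> /rails_not_crossing; rewrite rungs_crossing.
  by move=> _ _ _ /eqP ->.
exists s.1; first by rewrite inE; exact: map_f.
have reach (B : set (measurableTypeR R)) : measurable B ->
    (forall u, B u -> meets (relabel s.1 u z) s) ->
    step_prob <= fine (update_law (ltW q1) (threshold s.1 z) B) ->
    step_prob <= update_prob (ltW q1) s.1 z (progress k.+1).
  move=> mB Bs /le_trans; apply; rewrite -lee_fin update_probE; last exact: measurable_progress.
  rewrite fineK ?fin_num_measure//; apply: le_measure; rewrite ?inE//.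
    by apply: measurable_update; exact: measurable_progress.
  move=> u /Bs us; change (all (meets (relabel s.1 u z)) (take k.+1 script)).
  rewrite (take_nth (r0, InMiddle) ks) all_rcons us /=.
  by apply/allP => t tp; exact: keep.
have low_le : step_prob <= (1 + 2 * q)^-1 by rewrite ge_min lexx orbT.
have r0_mid : s.2 != InMiddle -> 3^-1 < z r0 <= 2 / 3.
  move=> sm; have := met (r0, InMiddle); apply; apply: earlier; first exact: mem_head.
  by move: sm; case: s.2.
have eE u : relabel s.1 u z s.1 = u by rewrite /relabel eqxx.
have r0E' u : s.2 != InMiddle -> relabel s.1 u z r0 = z r0.
  by move=> /e_r0; rewrite /relabel eq_sym => /negbTE ->.
have mitv (i : interval R) : measurable ([set` i] : set (measurableTypeR R)).
  exact: measurable_itv.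
case sd : s.2; rewrite sd in r0_mid r0E' earlier.
- apply: (reach `]3^-1, 2 / 3]%classic) => //.
    by move=> u /=; rewrite in_itv /meets sd eE.
  by rewrite set_itvE; apply: le_trans low_le (update_law_mid _ _).
- apply: (reach `]-oo, 3^-1]%classic) => //.
    by move=> u /=; rewrite in_itv /meets sd eE.
  by rewrite set_itvE; apply: le_trans low_le (update_law_low _ _).
- apply: (reach `]2 / 3, +oo[%classic) => //.
    move=> u /=; rewrite in_itv /= andbT /meets sd eE r0E'// => u23.
    by have /andP[_ /le_trans] := r0_mid isT; apply; exact: ltW.
  rewrite set_itvE; apply: le_trans low_le (le_trans _ (update_law_high q1 _ _)).
    by rewrite (_ : 1 - 2 / 3 = 3^-1); [rewrite lef_pV2 ?posrE; lra|field].
  by lra.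
have thr : threshold s.1 z = z r0.
  have := ss; rewrite mem_script sd => /andP[s_r0 /mapP[i]].
  rewrite mem_iota => /andP[_ iN] sE; apply: (threshold_rung (N := N) r0E sE) => //.
  - apply/andP; split=> //; rewrite lt0n; apply: contraNneq s_r0 => i0.
    by apply/eqP/val_inj; rewrite r0E -i0.
  - exact: r0_mid.
  - move=> f fr; apply: (met (f, IsLow)); apply: earlier => //.
    by rewrite mem_script.
  - move=> f fc f0; apply: (met (f, AboveFirst)); apply: earlier => //.
    by rewrite mem_script /= f0.
apply: (reach [set threshold s.1 z]) => //.
  by move=> u /= ->; rewrite /meets sd eE r0E'// thr.
have /andP[z1 z2] := r0_mid isT.
by rewrite ge_min update_law_atom// thr.
Qed.
End one_more_step.

End script.

(** * Many ladders in a large box *)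

Lemma script_edges_near (L : box) (x : int) (N : nat) (r0 e : edges L) :
  (0 < N)%N -> val r0 = rung x 0 -> e \in script_edges x N r0 ->
  x <= (val e).1.1 + 1 <= x + N%:Z.
Proof.
move=> N0 r0E /script_edgeP[d]; rewrite mem_script//.
case: d => /= [/eqP ->||/andP[_]|/andP[_]]; first by rewrite r0E /=; lia.
all: rewrite -/(val e); case: (val e) => [[a b] d].
- by rewrite mem_rails /=; lia.
- by rewrite /crossing /bottom_row /edge_src /edge_tgt; case: d => /=; lia.
- by rewrite mem_rungs /=; lia.
Qed.

(** The common label can be taken to be that of one of the edges, which turns the
    event into a finite union over the edges and the sets of edges. *)
Lemma measurable_large_cloud (R : realType) (L : box) (N : nat) : (0 < N)%N ->
  measurable (large_cloud N : set (labelling R L)).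
Proof.
move=> N0.
have mle := @measurable_label R L.
have meq (e f : edges L) : measurable [set z : labelling R L | z f == z e].
  have mb : measurable_fun setT (fun z : labelling R L => z f == z e).
    exact: measurable_fun_eqr.
  have := mb measurableT [set true] I.
  by rewrite setTI; congr measurable; apply/seteqP; split.
have mit (e : edges L) : measurable [set z : labelling R L | 0 < z e < 1].
  have := mle e measurableT `]0, 1[%classic (measurable_itv _).
  by rewrite setTI; congr measurable; apply/seteqP; split=> z /=; rewrite in_itv.
rewrite (_ : large_cloud N = \bigcup_(e in [set: edges L])
   ([set z | 0 < z e < 1] `&`
    \bigcup_(S in [set S : {set edges L} | (N <= #|S|)%N])
      \bigcap_(f in [set f | f \in S]) [set z | z f == z e])).
  apply: fin_bigcup_measurable => // e _; apply: measurableI => //.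
  apply: fin_bigcup_measurable => // S _.
  exact: fin_bigcap_measurable.
apply/seteqP; split=> z /=.
  move=> [p [p01 Np]].
  have /card_gt0P[e] : (0 < #|[pred e : edges L | z e == p]|)%N by exact: leq_trans Np.
  rewrite inE => /eqP ep; exists e => //; split; first by rewrite /= ep.
  exists [set f | z f == p]%SET; first by rewrite /= cardsE.
  by move=> f /=; rewrite inE ep.
move=> [e _ [e01 [S /= NS Sz]]]; exists (z e); split=> //.
by apply: leq_trans NS _; apply/subset_leq_card/fintype.subsetP => f /Sz.
Qed.

(** Ladders with consecutive corners share no edge: the edges of each of them,
    including those that leave it sideways, have their lower-left end in an
    interval of [N + 1] abscissae. *)
Definition ladder_corner (N i : nat) : int := (i * N.+1)%:Z.

Definition wide_box (m N : nat) : box := Box (-1, -1) (m * N.+1) 2.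

Definition miss_prob (R : realType) (q : R) (N : nat) : R :=
  1 - (step_prob q / ((5 * N + 3)%N%:R + step_prob q)) ^+ (5 * N + 3).

Section wide_enough.
Variables (R : realType) (q : R) (q1 : 1 < q) (L : box) (N m : nat).
Hypothesis N0 : (0 < N)%N.
Hypothesis wide : (vertices (wide_box m N) `<=` vertices L)%fset.

Let in_wide (i : 'I_m) (f : lattice_edge) :
  (f \in rungs (ladder_corner N i) N) || (f \in rails (ladder_corner N i) N) ->
  f \in edges L.
Proof.
rewrite mem_rungs mem_rails => h; rewrite in_edges.
have im : (i * N.+1 + N.+1 <= m * N.+1)%N by rewrite -mulSnr leq_mul2r ltn_ord orbT.
apply/andP; split; apply: (fsubsetP wide); rewrite in_vertices; move: h;
  rewrite /ladder_corner /edge_src /edge_tgt /=; case: f => [[a b] []] /=; lia.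
Qed.

Let r0_in (i : 'I_m) : rung (ladder_corner N i) 0 \in edges L.
Proof. by apply: (in_wide (i := i)); rewrite mem_rungs /=; lia. Qed.

Let r0 (i : 'I_m) : edges L := [` r0_in i]%fset.

Lemma large_cloud_ge (mu : probability (labelling R L) R) :
  invariant_measure (ltW q1) mu ->
  1 - miss_prob q N ^+ m <= fine (mu (large_cloud N)).
Proof.
move=> hmu; have c0 := step_prob_gt0 q1.
pose region (i : 'I_m) := script_edges (ladder_corner N i) N (r0 i).
pose D (i : 'I_m) := @progress R L (ladder_corner N i) N (r0 i).
pose h (i : 'I_m) := size (script (ladder_corner N i) N (r0 i)).
have mC := @measurable_large_cloud R L N N0.
have rungs_in (i : 'I_m) f : f \in rungs (ladder_corner N i) N -> f \in edges L.
  by move=> fr; apply: (in_wide (i := i)); rewrite fr.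
have rails_in (i : 'I_m) f : f \in rails (ladder_corner N i) N -> f \in edges L.
  by move=> fr; apply: (in_wide (i := i)); rewrite fr orbT.
have disj (i j : 'I_m) e : e \in region i -> e \in region j -> i = j.
  move=> /script_edges_near - /(_ N0 erefl) ei /script_edges_near - /(_ N0 erefl) ej.
  apply/val_inj => /=; move: ei ej; rewrite /ladder_corner.
  have [||//] := ltngtP i j => ij.
    have : (i * N.+1 + N.+1 <= j * N.+1)%N by rewrite -mulSnr leq_mul2r ij orbT.
    by lia.
  have : (j * N.+1 + N.+1 <= i * N.+1)%N by rewrite -mulSnr leq_mul2r ij orbT.
  by lia.
pose K := (5 * N + 3)%N.
pose c := step_prob q; pose x := c / (K%:R + c).
have x0 : 0 < x by rewrite divr_gt0// ltr_wpDl.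
have x1 : x <= 1 by rewrite ler_pdivrMr ?ltr_wpDl// mul1r lerDr.
pose avoid := [set z | forall i, i \in [set: 'I_m]%SET -> ~ D i (h i) z].
have mD i k : measurable (D i k) by exact: measurable_progress.
have mavoid : measurable avoid by exact: measurable_avoid_regions.
have avoid_le : fine (mu avoid) <= \prod_(i in [set: 'I_m]%SET) (1 - x ^+ h i).
  apply: (@avoid_regions_le R q (ltW q1) L 'I_m region D h K%:R c disj) => //.
  - by move=> i k e u z; exact: progress_local.
  - by move=> i; rewrite ler_nat; exact: card_script_edges.
  - by move=> i k z; apply: progress_step => // f; exact: rails_in.
have prod_le : \prod_(i in [set: 'I_m]%SET) (1 - x ^+ h i) <= miss_prob q N ^+ m.
  rewrite -[m in leRHS]card_ord -cardsT -prodr_const; apply: ler_prod => i _.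
  apply/andP; split; first by rewrite subr_ge0 exprn_ile1// ltW.
  rewrite /miss_prob -/K -/c -/x lerD2l lerN2.
  by apply: ler_wiXn2l => //; [exact: ltW|exact: size_script].
have : fine (mu (~` large_cloud N)) <= fine (mu avoid).
  rewrite fine_le ?fin_num_measure//; [exact: measurableC|].
  apply: le_measure; rewrite ?inE//; first exact: measurableC.
  move=> z zC i _ /progress_large_cloud zD; apply: zC; apply: zD => //.
  exact: rungs_in.
rewrite probability_setC// fineB ?fin_num_measure// [fine 1]/= => miss_le.
rewrite lerBlDr -lerBlDl.
exact: le_trans miss_le (le_trans avoid_le prod_le).
Qed.

End wide_enough.

Theorem proposition3p7 (R : realType) (q : R) (hq : 1 < q) (N : nat)
    (hN : (1 <= N)%N)
    (mu : forall L : box, probability (labelling R L) R)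
    (hmu : forall L : box, invariant_measure (ltW hq) (mu L)) :
  (fun L : box => mu L (large_cloud N)) @ boxes_to_plane --> (1 : \bar R)%E.
Proof.
have c0 := step_prob_gt0 hq.
pose K := (5 * N + 3)%N.
have x01 : 0 < (step_prob q / (K%:R + step_prob q)) ^+ K <= 1.
  have d0 : 0 < K%:R + step_prob q by rewrite ltr_wpDl.
  have x1 : step_prob q / (K%:R + step_prob q) <= 1.
    by rewrite ler_pdivrMr// mul1r lerDr.
  by rewrite exprn_gt0 ?divr_gt0//= exprn_ile1// divr_ge0// ltW.
have miss01 : 0 <= miss_prob q N < 1.
  by rewrite /miss_prob -/K; lra.
apply/fine_cvgP; split.
  by apply: nearW => L; rewrite fin_num_measure//; exact: measurable_large_cloud.
apply/cvgrPdist_le => eps eps0.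
have : `|miss_prob q N| < 1 by case/andP: miss01 => m0 m1; rewrite ger0_norm.
move=> /cvg_expr /cvgrPdist_le /(_ eps eps0) [m _ /(_ m (leqnn m))] /=.
rewrite sub0r normrN ger0_norm; last by rewrite exprn_ge0//; case/andP: miss01.
move=> small; exists (wide_box m N) => L wide /=.
move: (large_cloud_ge hN wide (hmu L)).
have upper : fine (mu L (large_cloud N)) <= 1.
  rewrite -lee_fin fineK ?probability_le1 ?fin_num_measure//; exact: measurable_large_cloud.
rewrite ger0_norm ?subr_ge0// lerBlDr => lower.
by rewrite lerBlDl (le_trans lower)// lerD2l.
Qed.
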